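(* Let $X,Y$ be real Hilbert spaces, $g\in\Gamma_0(X)$, $h\in\Gamma_0(Y)$, $A:X\to Y$ a bounded linear operator, and $f=g+h\circ A$. Suppose that $\operatorname{argmin} f\neq\emptyset$. Let $\Omega\subset X$ and assume that: (a) $0\in\operatorname{sri}(\operatorname{dom} h-A(\operatorname{dom} g))$; (b) $g$ is strictly convex on its domain; (c) $g$ is $p$-tilt-conditioned on $\Omega$ for some $p\in[1,+\infty[$. Then $f$ is $p$-conditioned on $\Omega$. Moreover there is some $u\in X$ such that, with $\tilde g:=g+\langle\cdot,u\rangle$, one can take $\gamma_{f,\Omega}=\gamma_{\tilde g,\Omega}$, i.e. $\tilde g$ is $p$-conditioned on $\Omega$ and any conditioning constant of $\tilde g$ on $\Omega$ is a conditioning constant of $f$ on $\Omega$.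
   Context: $\Gamma_0(X)$ is the set of proper, convex, lower semicontinuous functions $X\to]-\infty,+\infty]$. For a convex set $C$, the strong relative interior is $\operatorname{sri} C=\{x\in C:\operatorname{cone}(C-x)=\overline{\operatorname{span}}(C-x)\}$, where $\operatorname{cone}(D)=\bigcup_{t>0}tD$ and $\overline{\operatorname{span}}$ is the closed linear span. For $f\in\Gamma_0(X)$ with $\operatorname{argmin} f\neq\emptyset$ and $p\in[1,+\infty[$, $f$ is $p$-conditioned on $\Omega$ with constant $\gamma_{f,\Omega}>0$ if $\frac{\gamma_{f,\Omega}}{p}\operatorname{dist}(x,\operatorname{argmin} f)^p\le f(x)-\inf f$ for all $x\in\Omega\cap\operatorname{dom} f$. $g\in\Gamma_0(X)$ is $p$-tilt-conditioned on $\Omega$ if, for every $u\in X$, the function $g+\langle u,\cdot\rangle$ either has no minimizers or is $p$-conditioned on $\Omega$. *)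

(* Defs.v *)
From HB Require Import structures.
From mathcomp Require Import all_boot all_order all_algebra sesquilinear.
From mathcomp Require Import all_classical all_reals all_analysis.
Set Implicit Arguments.
Unset Strict Implicit.
Unset Printing Implicit Defensive.
Import Order.TTheory GRing.Theory Num.Theory.
Import numFieldNormedType.Exports.
Local Open Scope classical_set_scope.
Local Open Scope ring_scope.

(* A real Hilbert space is a complete normed module whose norm is induced by a
   symmetric positive definite bilinear form. *)
HB.mixin Record CompleteNormedModule_isHilbert (R : realType) V
    of CompleteNormedModule R V := {
  dotp : {dot V for (@idfun R)} ;
  dotpp_norm : forall x : V, dotp x x = `|x| ^+ 2
}.

#[short(type="hilbertType")]
HB.structure Definition Hilbert (R : realType) :=
  {V of CompleteNormedModule R V & CompleteNormedModule_isHilbert R V}.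

Section relative_interior.
Context {R : realType} {V : normedModType R}.
Implicit Types (C D : set V) (x : V).

Definition cone D : set V :=
  \bigcup_(t in [set t : R | 0 < t]) [set t *: d | d in D].

Definition lin_span D : set V :=
  [set v | exists (n : nat) (a : 'I_n -> R) (d : 'I_n -> V),
     (forall i, D (d i)) /\ v = \sum_(i < n) a i *: d i].

Definition closed_span D : set V := closure (lin_span D).

Definition sri C : set V :=
  [set x | C x /\ cone [set c - x | c in C] = closed_span [set c - x | c in C]].

End relative_interior.

Section extended_real_functions.
Context {R : realType} {V : normedModType R}.
Implicit Types f : V -> \bar R.
Local Open Scope ereal_scope.

Definition dom f : set V := [set x | f x < +oo].

Definition proper_fun f := (forall x, f x != -oo) /\ dom f !=set0.

(* No indeterminate sum occurs on the right-hand side as long as f does not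
   take the value -oo. *)
Definition econvex f := forall (x y : V) (t : R), (0 < t < 1)%R ->
  f (t *: x + (1 - t) *: y)%R <= t%:E * f x + (1 - t)%R%:E * f y.

Definition strictly_convex_on_dom f := forall (x y : V) (t : R),
  dom f x -> dom f y -> x <> y -> (0 < t < 1)%R ->
  f (t *: x + (1 - t) *: y)%R < t%:E * f x + (1 - t)%R%:E * f y.

Definition Gamma0 f := [/\ proper_fun f, econvex f & lower_semicontinuous f].

Definition inf_val f : \bar R := ereal_inf (range f).

Definition argmin f : set V := [set x | f x = inf_val f].

(* The standing requirements f \in Gamma0 and argmin f != set0 are part of the
   notion; in particular inf_val f is finite and the distance is too. *)
Definition conditioned_with (p : R) (Omega : set V) (gamma : R) f :=
  [/\ Gamma0 f, argmin f !=set0, (0 < gamma)%R &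
    forall x, Omega x -> dom f x ->
      (gamma / p)%:E * edist_inf (argmin f) x `^ p <= f x - inf_val f].

Definition conditioned p Omega f :=
  exists gamma, conditioned_with p Omega gamma f.

End extended_real_functions.

Section tilt.
Context {R : realType} {X : hilbertType R}.
Local Open Scope ereal_scope.

Definition tilt (g : X -> \bar R) (u : X) : X -> \bar R :=
  fun x => g x + (dotp u x)%:E.

Definition tilt_conditioned (p : R) (Omega : set X) (g : X -> \bar R) :=
  forall u : X,
    argmin (tilt g u) = set0 \/ conditioned p Omega (tilt g u).

End tilt.

(* Main.v *)
Require Import Defs.
From mathcomp Require Import all_boot all_order all_algebra.
From mathcomp Require Import all_classical all_reals all_analysis.
From mathcomp Require Import ring lra sesquilinear.
Import Order.TTheory GRing.Theory Num.Theory.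
Import numFieldNormedType.Exports.
Local Open Scope classical_set_scope.
Local Open Scope ring_scope.

(**
Let [xb] minimise [f = g + h o A] and write [m] for the minimum. The theorem
reduces to the existence of a dual certificate at [xb]: a vector [v] of [Y]
such that [v] is a subgradient of [h] at [A xb] and [- A^* v] is a subgradient
of [g] at [xb]. Given [v], put [u := A^* v]. The second property says that
[xb] minimises the tilted function [g + <u, .>]; by strict convexity it is the
only minimiser, so that [argmin (tilt g u) = {xb}] is included in [argmin f].
The first property gives, for all [x],

   [f x - m >= (g x + <u, x>) - (g xb + <u, xb>)].

Hence an inequality bounding a power of the distance to [argmin (tilt g u)] by
the growth of [tilt g u] implies the same inequality, with the same constant,
for [f]. Since [tilt g u] has a minimiser, tilt-conditioning of [g] says that
it is conditioned.

Both properties of [v] together say that [m + <v, y> <= F (x, y)] for all [x]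
and [y], where [F (x, y) := g x + h (A x + y)] is the perturbation function of
the problem; in other words, [v] is a subgradient at [0] of the value function
[y |-> inf_x F (x, y)]. This is the Attouch-Brezis theorem,
[value_function_subgradient]. Its proof has two parts.

- Boundedness. The values of the second coordinate on [dom F] are the points of
  [dom h - A (dom g)], and by the constraint qualification the cone that they
  span is a closed subspace [Z]. Let [K] be the set of those [(x, y)] at which
  [x] has norm at most [1] and [F (xb + x, y) <= m + 1]. It is closed and
  convex, and its projection to [Y] absorbs [Z]. A Baire argument in [Z]
  together with the summation of a geometric series, as in the open mapping
  theorem, shows that the projection contains a ball of [Z]
  ([projection_nbhs0]): the value function is at most [m + 1] near [0] in [Z].

- Separation. By convexity, that bound makes all slopes of the value function
  at [0] in direction [y] at least [- L |y|] for some [L]. The directions and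
  slopes [(y, s)] form a convex cone. Minimising [s + |y|^2 / 2] over this cone
  is a strongly convex problem, whose minimising sequences have a limit [y0] in
  the first coordinate by the parallelogram law, and [v := - y0] satisfies
  [<v, y> <= s] on the cone ([cone_support]). In a Hilbert space this replaces
  the Hahn-Banach and the Riesz theorem at once; the adjoint [A^* v] is obtained
  in the same way, from the graph of [x |-> <v, A x>].
*)

(** * Completeness and a Baire theorem for closed subsets *)

Lemma geometric_steps_cvg (R : realType) (V : completeNormedModType R)
    (u : nat -> V) (c : R) :
  (forall n, `|u n.+1 - u n| <= c * 2^-1 ^+ n) -> cvgn u.
Proof.
move=> uc; have : cvgn (series (telescope u)).
  apply: normed_cvg; apply: (series_le_cvg _ _ (v_ := geometric c 2^-1)).
  - by move=> n; exact: normr_ge0.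
  - by move=> n; rewrite /geometric /=; exact: le_trans (normr_ge0 _) (uc n).
  - by move=> n; exact: uc.
  - by apply: is_cvg_geometric_series; rewrite ger0_norm; lra.
rewrite (_ : series _ = fun n => u n - u 0%N); last first.
  by apply/funext => n; rewrite seriesEnat /= telescope_sumr.
move=> cu; rewrite (_ : u = (fun n => u n - u 0%N) \+ cst (u 0%N)); last first.
  by apply/funext => n /=; rewrite subrK.
by apply: is_cvgD => //; exact: is_cvg_cst.
Qed.

Lemma closure_normP (R : realType) (V : normedModType R) (S : set V) (z : V) :
  closure S z <-> forall e, 0 < e -> exists2 s, S s & `|z - s| < e.
Proof.
split=> [clz e e0|clz B /nbhs_ballP[e /= e0 Be]].
  have [s [Ss]] := clz _ (nbhsx_ballx z e e0).
  by rewrite -ball_normE; exists s.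
have [s Ss zs] := clz e e0; exists s; split=> //.
by apply: Be; rewrite -ball_normE.
Qed.

(** The Baire theorem for [Z] with its induced topology. It is stated for
subsets of the ambient space so that a subspace, which has empty interior when
it is proper, need not be made into a normed space of its own. If every
relative ball of [Z] left every [F k], one could choose nested balls centred in
[Z], the [k]-th one avoiding [F k]; the limit of the centres would be a point
of [Z] in no [F k]. *)
Lemma Baire_closed_subset (R : realType) (V : completeNormedModType R)
    (Z : set V) (F : nat -> set V) :
  closed Z -> Z !=set0 -> (forall k, closed (F k)) ->
  Z `<=` \bigcup_k F k ->
  exists k z r, [/\ Z z, 0 < r &
    forall w, Z w -> `|w - z| < r -> F k w].
Proof.
move=> clZ [z0 Zz0] clF ZF; apply: contrapT => nF.
have avoid k z r : Z z -> 0 < r ->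
    exists2 w, Z w /\ `|w - z| < r & ~ F k w.
  move=> Zz r0; apply: contrapT => nw; apply: nF.
  exists k, z, r; split=> // w Zw wz.
  by apply: contrapT => nFw; apply: nw; exists w.
(* A state [s] is a ball with its centre and radius; the next ball lies inside
   it, has at most half its radius and misses [F k]. *)
have step k (s : V * R) : exists s' : V * R, Z s.1 -> 0 < s.2 ->
    [/\ Z s'.1, 0 < s'.2, s'.2 <= s.2 / 2, `|s'.1 - s.1| + s'.2 <= s.2 &
        forall v, `|v - s'.1| <= s'.2 -> ~ F k v].
  have [[Zs s0]|ns] := pselect (Z s.1 /\ 0 < s.2); last first.
    by exists s => Zs s0; case: ns.
  have [w [Zw ws] nFw] := avoid k _ _ Zs s0.
  have /nbhs_ballP[e /= e0 eF] : nbhs w (~` F k).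
    by apply: open_nbhs_nbhs; split=> //; exact/closed_openC/clF.
  exists (w, Num.min (s.2 / 2) (Num.min (s.2 - `|w - s.1|) (e / 2))) => _ _.
  split=> //=.
  - by rewrite !lt_min; apply/and3P; split; lra.
  - by rewrite ge_min lexx.
  - rewrite -lerBrDl ge_min; apply/orP; right.
    by rewrite ge_min lexx.
  - move=> v; rewrite !le_min => /and3P[_ _ ve]; apply: eF.
    by rewrite -ball_normE /= distrC; apply: le_lt_trans ve _; lra.
have {step}[next nextP] := choice (fun ks => step ks.1 ks.2).
pose s := fix s n := if n is m.+1 then next (m, s m) else (z0, 1 : R).
have sP n : Z (s n).1 /\ 0 < (s n).2.
  by elim: n => [|n [IH1 IH2]] //=; have [] := nextP (n, s n) IH1 IH2.
have {}nextP n := nextP (n, s n) (sP n).1 (sP n).2.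
have rad n : (s n).2 <= 2^-1 ^+ n.
  elim: n => [|n IH] /=; first by rewrite expr0.
  by have [_ _ h _ _] := nextP n; apply: le_trans h _; rewrite exprS; lra.
have nested n m : `|(s (n + m)%N).1 - (s n).1| + (s (n + m)%N).2 <= (s n).2.
  elim: m => [|m IH]; first by rewrite addn0 subrr normr0 add0r.
  rewrite addnS; have [_ _ _ h _] := nextP (n + m)%N.
  have := ler_distD (s (n + m)%N).1 (s (n + m).+1).1 (s n).1.
  by move: h IH => /=; lra.
have /cvg_ex[l sl] : cvgn (fun n => (s n).1).
  apply: (@geometric_steps_cvg _ _ _ 1) => n; rewrite mul1r.
  have [_ p _ h _] := nextP n; apply: le_trans (rad n).
  by move: p h => /=; lra.
have Zl : Z l.
  apply: (closed_cvg _ clZ _ _ sl).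
  by apply: nearW => n; exact: (sP n).1.
have [k _] := ZF l Zl.
have [_ _ _ _] := nextP k; apply.
change (`|l - (s k.+1).1| <= (s k.+1).2).
have cvd : (fun n => `|(s n).1 - (s k.+1).1|) @ \oo --> `|l - (s k.+1).1|.
  by apply: cvg_norm; apply: cvgB => //; exact: cvg_cst.
apply: (closed_cvg _ (@closed_le _ (s k.+1).2) _ _ cvd).
near=> n; have /subnKC <- : (k.+1 <= n)%N by near: n; exact: nbhs_infty_ge.
have := nested k.+1 (n - k.+1)%N; have := (sP (k.+1 + (n - k.+1))%N).2.
by rewrite /=; lra.
Unshelve. all: by end_near. Qed.

(** * Projections of closed convex sets *)

Lemma closure_convex (R : realType) (V : normedModType R) (S : set V) :
  (forall (x y : V) (t : R), 0 < t < 1 -> S x -> S y ->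
    S (t *: x + (1 - t) *: y)) ->
  forall (x y : V) (t : R), 0 < t < 1 -> closure S x -> closure S y ->
    closure S (t *: x + (1 - t) *: y).
Proof.
move=> cS x y t t01 /closure_normP clx /closure_normP cly.
apply/closure_normP => e e0.
have [a Sa xa] := clx e e0; have [b Sb yb] := cly e e0.
exists (t *: a + (1 - t) *: b); first exact: cS.
rewrite opprD addrACA -!scalerBr (le_lt_trans (ler_normD _ _))// !normrZ.
have /andP[t0 t1] := t01; rewrite !gtr0_norm; [|lra|lra].
have : t * `|x - a| < t * e by rewrite ltr_pM2l.
have : (1 - t) * `|y - b| < (1 - t) * e by rewrite ltr_pM2l //; lra.
by lra.
Qed.

Section open_projection.
Context {R : realType} {X Y : completeNormedModType R}.
Variables (K : set (X * Y)) (Z : set Y) (M : R).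
Hypothesis K_closed : closed K.
Hypothesis K_convex : forall (w1 w2 : X * Y) (t : R), 0 < t < 1 ->
  K w1 -> K w2 -> K (t *: w1 + (1 - t) *: w2).
Hypothesis K0 : K 0.
Hypothesis K_bounded : forall w, K w -> `|w.1| <= M.
Hypothesis KZ : forall w, K w -> Z w.2.
Hypothesis Z_closed : closed Z.
Hypothesis Z_linear : forall (a : R) (y z : Y), Z y -> Z z -> Z (a *: y + z).
Hypothesis K_absorbs : forall y, Z y ->
  exists (t : R) (x : X), 0 < t /\ K (x, t *: y).

Local Notation D := [set w.2 | w in K].

Let Z0 : Z 0. Proof. exact: KZ K0. Qed.

Let K_star (a : R) w : 0 < a <= 1 -> K w -> K (a *: w).
Proof.
move=> /andP[a0]; rewrite le_eqVlt => /orP[/eqP->|a1] Kw.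
  by rewrite scale1r.
have := K_convex w 0 a _ Kw K0.
by rewrite scaler0 addr0; apply; rewrite a0.
Qed.

Let D_closure_convex (x y : Y) (t : R) : 0 < t < 1 ->
  closure D x -> closure D y -> closure D (t *: x + (1 - t) *: y).
Proof.
apply: closure_convex => _ _ s s01 [w Kw <-] [w' Kw' <-].
by exists (s *: w + (1 - s) *: w') => //; exact: K_convex.
Qed.

(** The dilations of the closure of [D] by the positive integers cover [Z], so
one of them has a relatively interior point [z]. As [D] also absorbs [- z], a
convex combination of a ball around a multiple of [z] and of a negative multiple
of [z] is a ball around [0]. *)
Lemma closure_projection_nbhs0 :
  exists2 r, 0 < r & forall y, Z y -> `|y| < r -> closure D y.
Proof.
have [|k|z Zz|k [z [r [Zz r0 zr]]]] := @Baire_closed_subset R Y Z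
    (fun k => [set z | closure D ((k.+1%:R^-1 : R) *: z)]) Z_closed.
- by exists 0; exact: Z0.
- apply: closed_comp (@closed_closure _ _) => y _.
  exact: scaler_continuous.
- have [t [x [t0 Ktx]]] := K_absorbs z Zz.
  have [k tk] : exists k, t^-1 < k.+1%:R.
    by exists (Num.truncn t^-1); exact: truncnS_gt.
  exists k => //=; apply: subset_closure.
  exists (((k.+1%:R^-1 / t) : R) *: (x, t *: z)); last first.
    by rewrite /= scalerA divfK // gt_eqF.
  apply: K_star => //; rewrite divr_gt0 //=.
  by rewrite ler_pdivrMr // mul1r invf_ple ?posrE //; exact: ltW.
set c : R := k.+1%:R^-1 in zr; have c0 : 0 < c by rewrite invr_gt0.
have [t [x [t0 Ktx]]] : exists (t : R) (x : X), 0 < t /\ K (x, t *: - z).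
  apply: K_absorbs; have := Z_linear (-1) z 0 Zz Z0.
  by rewrite addr0 scaleN1r.
(* This weight makes the contributions of [z] and [- z] cancel. *)
pose l := t / (c + t).
have l0 : 0 < l by rewrite divr_gt0 // addr_gt0.
have lc : l * c = (1 - l) * t.
  by rewrite /l; field; rewrite gt_eqF // addr_gt0.
have l1 : l < 1 by rewrite /l ltr_pdivrMr ?addr_gt0 // mul1r; lra.
have lc0 : 0 < l * c by rewrite mulr_gt0.
exists (r * (l * c)); first by rewrite mulr_gt0.
move=> w Zw wr.
rewrite (_ : w = l *: (c *: ((l * c)^-1 *: w + z)) + (1 - l) *: (t *: - z)).
  apply: D_closure_convex; first by rewrite l0.
    apply: zr; first exact: Z_linear.
    rewrite addrK normrZ gtr0_norm ?invr_gt0 // mulrC.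
    by rewrite ltr_pdivrMr.
  by apply: subset_closure; exists (x, t *: - z).
rewrite !scalerA -lc scalerN scalerDr scalerA mulfV ?gt_eqF // scale1r.
by rewrite addrK.
Qed.

(** The passage from the closure of [D] to [D] itself. Approximate [2 y] by a
point of [D], double the error, approximate it again, and so on: this writes
[y] as a series with weights [2^-k] of points of [D]. Their preimages in [K]
have bounded first coordinates, so that the corresponding series converges in
[X], and its sum lies in [K] because [K] is convex and closed. *)
Lemma projection_nbhs0 :
  exists2 r, 0 < r & forall y, Z y -> `|y| < r -> D y.
Proof.
have [r r0 clD] := closure_projection_nbhs0.
exists (r / 2); first by rewrite divr_gt0.
move=> y Zy yr.
have step (q : Y) : exists w : X * Y, Z q -> `|q| < r ->
    K w /\ `|q - w.2| < r / 2.
  have [[Zq qr]|nq] := pselect (Z q /\ `|q| < r); last first.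
    by exists 0 => Zq qr; case: nq.
  have /closure_normP := clD q Zq qr.
  case/(_ (r / 2)); first by rewrite divr_gt0.
  by move=> _ [w Kw <-] qw; exists w.
have {step}[next nextP] := choice step.
pose q := fix q n := if n is m.+1 then 2 *: (q m - (next (q m)).2) else 2 *: y.
have qP n : Z (q n) /\ `|q n| < r.
  elim: n => [|n [Zq qr]] /=.
    split; first by have := Z_linear 2 y 0 Zy Z0; rewrite addr0.
    by rewrite normrZ ger0_norm //; lra.
  have [Kn qn] := nextP _ Zq qr; split.
    rewrite -[_ *: _]addr0; apply: Z_linear => //.
    by rewrite addrC -scaleN1r; apply: Z_linear => //; exact: KZ.
  by rewrite normrZ ger0_norm //; lra.
have {}nextP n := nextP _ (qP n).1 (qP n).2.
pose S n : X * Y := \sum_(k < n) (2^-1 : R) ^+ k.+1 *: next (q k).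
have SS n : S n.+1 = S n + (2^-1 : R) ^+ n.+1 *: next (q n).
  by rewrite /S big_ord_recr.
have KS n w : K w -> K (S n + (2^-1 : R) ^+ n *: w).
  elim: n w => [|n IH] w Kw.
    by rewrite /S big_ord0 add0r expr0 scale1r.
  rewrite SS -addrA -scalerDr exprSr -scalerA; apply: IH.
  rewrite scalerDr {2}(_ : 2^-1 = 1 - 2^-1 :> R); last by field.
  by apply: K_convex => //; [lra|exact: (nextP n).1].
(* The missing weight [2^-n] is put on the point [0] of [K]. *)
have {}KS n : K (S n) by have := KS n 0 K0; rewrite scaler0 addr0.
have Sq n : y - (S n).2 = (2^-1 : R) ^+ n.+1 *: q n.
  elim: n => [|n IH].
    by rewrite /S big_ord0 subr0 scalerA expr1 mulVf // scale1r.
  rewrite SS /= opprD addrA IH -scalerBr [in RHS]scalerA; congr (_ *: _).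
  by rewrite [in RHS]exprSr divfK.
have /cvg_ex[x Sx] : cvgn (fun n => (S n).1).
  apply: (@geometric_steps_cvg _ _ _ (M / 2)) => n.
  rewrite SS /= addrC addKr normrZ ger0_norm ?exprn_ge0 //.
  have p0 : 0 <= (2^-1 : R) ^+ n by rewrite exprn_ge0.
  have := ler_wpM2l p0 (K_bounded _ (nextP n).1).
  by rewrite exprS; lra.
have Sy : (fun n => (S n).2) @ \oo --> y.
  apply/cvgrPdist_lt => e e0.
  have : (fun n => r * (2^-1 : R) ^+ n) @ \oo --> 0.
    by apply: cvg_geometric; rewrite ger0_norm; lra.
  move/cvgrPdist_lt => /(_ e e0); apply: filterS => n.
  rewrite sub0r normrN ger0_norm; last by rewrite mulr_ge0 ?exprn_ge0 // ltW.
  apply: le_lt_trans; rewrite Sq normrZ ger0_norm ?exprn_ge0 //.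
  have [_ /ltW qr] := qP n; rewrite exprS -mulrA.
  have p0 : 0 <= (2^-1 : R) ^+ n by rewrite exprn_ge0.
  have := ler_wpM2l p0 qr.
  have : 0 <= 2^-1 ^+ n * `|q n| by rewrite mulr_ge0.
  by lra.
exists (x, y) => //.
have cS : S @ \oo --> (x, y).
  apply: cvg_trans (cvg_pair Sx Sy); apply: near_eq_cvg.
  by apply: nearW => n; case: (S n).
by apply: (closed_cvg _ K_closed _ _ cS); exact: nearW.
Qed.

End open_projection.

(** * Supporting vectors of cones in a Hilbert space *)

Section inner_product.
Context {R : realType} {V : hilbertType R}.
Implicit Types x y z : V.

Lemma dotpC x y : dotp x y = dotp y x.
Proof. by rewrite hermC /= expr0 mul1r. Qed.

Lemma dotpDr x y z : dotp x (y + z) = dotp x y + dotp x z.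
Proof. exact: linearDr. Qed.

Lemma dotpDl x y z : dotp (x + y) z = dotp x z + dotp y z.
Proof. exact: linearDl. Qed.

Lemma dotpZr (a : R) x y : dotp x (a *: y) = a * dotp x y.
Proof. exact: linearZr. Qed.

Lemma dotpNr x y : dotp x (- y) = - dotp x y.
Proof. exact: linearNr. Qed.

Lemma dotpNl x y : dotp (- x) y = - dotp x y.
Proof. exact: linearNl. Qed.

Lemma normD_sqr x y : `|x + y| ^+ 2 = `|x| ^+ 2 + 2 * dotp x y + `|y| ^+ 2.
Proof. by rewrite -!dotpp_norm dotpDl !dotpDr (dotpC y x); ring. Qed.

(** The Cauchy-Schwarz inequality is read off from the triangle inequality by
squaring. *)
Lemma dotp_le_norm x y : dotp x y <= `|x| * `|y|.
Proof.
have := lerXn2r 2 (normr_ge0 (x + y)) (addr_ge0 (normr_ge0 x) (normr_ge0 y))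
  (ler_normD x y).
by rewrite normD_sqr sqrrD -mulr_natr; lra.
Qed.

Lemma dotp_ge_norm x y : - (`|x| * `|y|) <= dotp x y.
Proof. by have := dotp_le_norm (- x) y; rewrite dotpNl normrN; lra. Qed.

End inner_product.

Lemma ge0_of_small_error (R : realType) (a c : R) :
  (forall t, 0 < t <= 1 -> 0 <= a + t * c) -> 0 <= a.
Proof.
move=> h; rewrite leNgt; apply/negP => a0.
pose C := `|c| + 1.
have C0 : 0 < C by rewrite ltr_wpDl.
have cC : c <= C by apply: le_trans (ler_norm c) _; rewrite lerDl.
pose t := Num.min 1 (- a / (2 * C)).
have t0 : 0 < t by rewrite lt_min ltr01 divr_gt0 //; lra.
have tC : t * C <= - a / 2.
  have : t <= - a / (2 * C) by rewrite ge_min lexx orbT.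
  rewrite -(ler_pM2r C0) => /le_trans; apply.
  by rewrite le_eqVlt; apply/orP; left; apply/eqP; field; rewrite gt_eqF.
have tcC : t * c <= t * C by rewrite ler_wpM2l // ltW.
have := h t; rewrite t0 ge_min lexx => /(_ isT).
by lra.
Qed.

(** A form of the Hahn-Banach theorem. The lower bound on the cone [E] makes
[q y s := s + |y|^2 / 2] bounded below on [E]. By the parallelogram law the
first coordinates of a minimising sequence converge to some [y0]. Moving from an
almost minimal point in the direction [t *: (y, s)], which the cone allows,
gives [0 <= s + <y0, y>] in the limit of small [t]: this is the claim for
[v := - y0]. *)
Lemma cone_support (R : realType) (V : hilbertType R) (E : V -> R -> Prop)
    (L : R) :
  (forall y s y' s', E y s -> E y' s' -> E (y + y') (s + s')) ->
  (forall y s t, 0 < t -> E y s -> E (t *: y) (t * s)) ->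
  (forall y s, E y s -> - (L * `|y|) <= s) ->
  exists v, forall y s, E y s -> dotp v y <= s.
Proof.
move=> ED EZ EL.
have [[y1 [s1 E1]]|nE] := pselect (exists y s, E y s); last first.
  by exists 0 => y s Es; case: nE; exists y, s.
pose q (y : V) (s : R) := s + `|y| ^+ 2 / 2.
pose Q := [set r | exists y s, E y s /\ r = q y s].
have infQ : has_inf Q.
  split; first by exists (q y1 s1), y1, s1.
  exists (- (L ^+ 2 / 2)) => _ [y [s [Es ->]]].
  by have := EL _ _ Es; have := sqr_ge0 (`|y| - L); rewrite /q sqrrB; lra.
pose mu := inf Q.
have mu_le y s : E y s -> mu <= q y s.
  by move=> Es; apply: ge_inf; [exact: infQ.2|exists y, s].
have near_min (e : R) : 0 < e ->
    exists ys : V * R, E ys.1 ys.2 /\ q ys.1 ys.2 < mu + e.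
  move=> e0; have [_ [y [s [Es ->]]] qe] := inf_adherent e0 infQ.
  by exists (y, s).
have [w wP] := choice (fun n => near_min (((2^-1 : R) ^+ n) ^+ 2)
  ltac:(by rewrite !exprn_gt0 // invr_gt0)).
(* Half the sum of two points of [E] is in [E], so its value is at least [mu];
   the errors [4^-n] give steps of order [2^-n]. *)
have w_steps n : `|(w n.+1).1 - (w n).1| <= 3 * (2^-1 : R) ^+ n.
  set a := (2^-1 : R) ^+ n; have a0 : 0 <= a by rewrite exprn_ge0.
  have [En qn] := wP n; have [En1 qn1] := wP n.+1.
  have h2 : 0 < (2^-1 : R) by rewrite invr_gt0.
  have := mu_le _ _ (EZ _ _ _ h2 (ED _ _ _ _ En En1)).
  have := normD_sqr (w n).1 (w n.+1).1.
  have := normD_sqr (w n.+1).1 (- (w n).1).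
  move: qn qn1; rewrite /q dotpNr (dotpC (w n.+1).1) normrN normrZ gtr0_norm //.
  rewrite [_ ^+ n.+1]exprS -/a ![(2^-1 * _) ^+ 2]exprMn => qn qn1 e1 e2 e3.
  rewrite -(ler_pXn2r (n := 2)) ?nnegrE ?mulr_ge0 // exprMn.
  have := sqr_ge0 a.
  by lra.
have /cvg_ex[y0 wy0] := geometric_steps_cvg _ _ _ _ w_steps.
exists (- y0) => y s Es; rewrite dotpNl -subr_ge0 opprK.
apply: (ge0_of_small_error _ _ (`|y| ^+ 2 / 2 + 1 + `|y|)) => t /andP[t0 t1].
(* The error has to be of second order in [t] to survive the division by [t]. *)
have [n [wn an]] : exists n,
    `|y0 - (w n).1| < t /\ ((2^-1 : R) ^+ n) ^+ 2 < t ^+ 2.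
  have /cvgrPdist_lt/(_ t t0) := wy0.
  have : (fun n => 1 * (2^-1 : R) ^+ n) @ \oo --> 0.
    by apply: cvg_geometric; rewrite ger0_norm; lra.
  move/cvgrPdist_lt => /(_ t t0) h1 h2.
  near \oo => n; exists n; split; first by near: n.
  rewrite ltr_pXn2r ?nnegrE ?exprn_ge0 ?(ltW t0) //.
  have : `|0 - 1 * (2^-1 : R) ^+ n| < t by near: n.
  by rewrite mul1r sub0r normrN ger0_norm ?exprn_ge0.
have [En qn] := wP n.
have := mu_le _ _ (ED _ _ _ _ En (EZ _ _ _ t0 Es)).
rewrite /q normD_sqr dotpZr normrZ gtr0_norm // exprMn.
have yn : dotp (w n).1 y <= dotp y0 y + t * `|y|.
  have := dotp_ge_norm (y0 - (w n).1) y; rewrite dotpDl dotpNl.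
  have := ler_wpM2r (normr_ge0 y) (ltW wn); lra.
have tyn := ler_wpM2l (ltW t0) yn.
move=> mu_n; rewrite -(pmulr_rge0 _ t0).
have ty : t * (t * `|y|) <= t * (1 * `|y|) * 1.
  by rewrite mulr1 ler_wpM2l ?ler_wpM2r // ltW.
by move: qn; rewrite /q; lra.
Unshelve. all: by end_near. Qed.

(** The graph of the linear form [x |-> <v, A x>] is a cone, and an affine
inequality that holds on it for both [x] and [- x] is an equality. *)
Lemma adjoint_vector (R : realType) (X Y : hilbertType R) (A : {linear X -> Y})
    (M : R) :
  (forall x, `|A x| <= M * `|x|) ->
  forall v : Y, exists u : X, forall x, dotp u x = dotp v (A x).
Proof.
move=> AM v.
have [||x s ->|u uP] := @cone_support R X (fun x s => s = dotp v (A x))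
  (`|v| * M).
- by move=> x s x' s' -> ->; rewrite linearD dotpDr.
- by move=> x s t _ ->; rewrite linearZ dotpZr.
- apply: le_trans (dotp_ge_norm _ _); rewrite lerN2 -mulrA.
  by rewrite ler_wpM2l.
exists u => x; apply/eqP; rewrite eq_le uP //=.
by have := uP (- x) _ erefl; rewrite (linearN A) !dotpNr lerN2.
Qed.

(** * The closed linear span *)

Lemma lin_span_linear (R : realType) (V : normedModType R) (D : set V)
    (a : R) (y z : V) : lin_span D y -> lin_span D z -> lin_span D (a *: y + z).
Proof.
move=> [n [b [d [Dd ->]]]] [k [c [e [De ->]]]].
exists (n + k)%N.
exists (fun i =>
  match fintype.split i with inl j => a * b j | inr j => c j end).
exists (fun i => match fintype.split i with inl j => d j | inr j => e j end).
split; first by move=> i; case: (fintype.split i).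
rewrite big_split_ord scaler_sumr; congr (_ + _); apply: eq_bigr => i _.
  by rewrite -/(unsplit (inl i)) unsplitK scalerA.
by rewrite -/(unsplit (inr i)) unsplitK.
Qed.

Lemma closed_span_linear (R : realType) (V : normedModType R) (D : set V)
    (a : R) (y z : V) :
  closed_span D y -> closed_span D z -> closed_span D (a *: y + z).
Proof.
move=> /closure_normP cly /closure_normP clz; apply/closure_normP => e e0.
have a0 : 0 < `|a| + 1 by rewrite ltr_wpDl.
have [s Ss ys] := cly (e / 2 / (`|a| + 1)) ltac:(by rewrite !divr_gt0).
have [s' Ss' zs'] := clz (e / 2) ltac:(by rewrite divr_gt0).
exists (a *: s + s'); first exact: lin_span_linear.
rewrite opprD addrACA -scalerBr (le_lt_trans (ler_normD _ _))// normrZ.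
move: ys; rewrite ltr_pdivlMr // => ys.
by have := normr_ge0 (y - s); move: ys zs'; lra.
Qed.

(** * The Attouch-Brezis theorem *)

Section ereal_convex.
Context {R : realType} {V : normedModType R}.
Implicit Types (F : V -> \bar R) (w : V).

Lemma econvex_le F w1 w2 (t a b : R) : econvex F -> 0 < t < 1 ->
  (F w1 <= a%:E)%E -> (F w2 <= b%:E)%E ->
  (F (t *: w1 + (1 - t) *: w2)%R <= (t * a + (1 - t) * b)%:E)%E.
Proof.
move=> cF t01 Fa Fb; apply: le_trans (cF _ _ _ t01) _.
have /andP[t0 t1] := t01.
by rewrite [(t * a + _)%:E]EFinD !EFinM leeD // lee_wpmul2l // lee_fin; lra.
Qed.

Lemma closed_sublevel F (a : R) : lower_semicontinuous F ->
  closed [set w | (F w <= a%:E)%E].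
Proof.
move=> /lower_semicontinuousP/(_ a)/open_closedC.
by congr closed; apply/seteqP; split=> w /=; rewrite leNgt => /negP.
Qed.

Lemma dom_le F w : dom F w -> exists a : R, (F w <= a%:E)%E.
Proof.
rewrite /dom /=; case: (F w) => [r _|//|_]; first by exists r.
by exists 0; rewrite leNye.
Qed.

End ereal_convex.

Section value_function.
Context {R : realType} {X Y : hilbertType R}.
Variables (F : X * Y -> \bar R) (xb : X) (m : R).
Hypothesis F_convex : econvex F.
Hypothesis F_lsc : lower_semicontinuous F.
Hypothesis F_xb : F (xb, 0) = m%:E.
Hypothesis F_min : forall x, (m%:E <= F (x, 0%R))%E.
Hypothesis F_sri :
  cone [set w.2 | w in dom F] = closed_span [set w.2 | w in dom F].

Local Notation Z := (closed_span [set w.2 | w in dom F]).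
Local Notation b := ((xb, 0) : X * Y).

(** The point [(xb, 0)] is moved to the origin, and the bound on the first
coordinate makes the series of [projection_nbhs0] converge in [X]. *)
Let K := [set w : X * Y | `|w.1| <= 1 /\ (F (b + w)%R <= (m + 1)%:E)%E].

Let Z_dom w : dom F w -> Z w.2.
Proof.
move=> Fw; rewrite -F_sri; exists 1 => //=.
by exists w.2; [exists w|rewrite scale1r].
Qed.

Let K_closed : closed K.
Proof.
have cl1 : closed ((fun w : X * Y => `|w.1|) @^-1` [set r : R | r <= 1]).
  apply: preimage_closed (@closed_le _ 1) => w _.
  by apply: cvg_norm; exact: cvg_fst.
have cl2 : closed (+%R b @^-1` [set w | (F w <= (m + 1)%:E)%E]).
  apply: preimage_closed (closed_sublevel _ _ F_lsc) => w _.
  by apply: cvgD; [exact: cvg_cst|exact: cvg_id].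
exact: closedI cl1 cl2.
Qed.

Let K_convex (w1 w2 : X * Y) (t : R) : 0 < t < 1 ->
  K w1 -> K w2 -> K (t *: w1 + (1 - t) *: w2).
Proof.
move=> t01 [n1 F1] [n2 F2]; have /andP[t0 t1] := t01; split.
  rewrite /= (le_trans (ler_normD _ _))// !normrZ !gtr0_norm ?subr_gt0 //.
  have := ler_wpM2l (ltW t0) n1; have : 0 <= 1 - t by rewrite subr_ge0 ltW.
  by move/ler_wpM2l/(_ _ _ n2); lra.
have := econvex_le _ _ _ _ _ _ F_convex t01 F1 F2.
rewrite (_ : t * _ + _ = m + 1); last by ring.
by rewrite !scalerDr addrACA -scalerDl subrKC scale1r.
Qed.

Let K0 : K 0.
Proof.
by split; rewrite ?normr0 // addr0 F_xb lee_fin lerDl.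
Qed.

(** Along the segment from [(xb, 0)] to a point of [dom F], convexity keeps the
value of [F] below [m + 1] close to [(xb, 0)]. *)
Let K_absorbs y : Z y -> exists (t : R) (x : X), 0 < t /\ K (x, t *: y).
Proof.
rewrite -F_sri => -[t /= t0 [_ [w Fw <-] <-]].
have [c Fc] := dom_le _ _ Fw.
(* [N^-1] is a step small enough for both conditions defining [K]. *)
pose N := 2 + `|c - m| + `|w.1 - xb|.
have N1 : 1 < N.
  by have := normr_ge0 (c - m); have := normr_ge0 (w.1 - xb); rewrite /N; lra.
have N0 : 0 < N by lra.
have i0 : 0 < N^-1 by rewrite invr_gt0.
have i1 : N^-1 < 1 by rewrite invf_lt1.
exists (N^-1 / t), (N^-1 *: (w.1 - xb)); split; first by rewrite divr_gt0.
rewrite scalerA divfK ?gt_eqF //; split.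
  rewrite /= normrZ gtr0_norm // mulrC ler_pdivrMr // mul1r.
  by have := normr_ge0 (c - m); rewrite /N; lra.
have Fb : (F b <= m%:E)%E by rewrite F_xb.
have := econvex_le _ _ _ N^-1 _ _ F_convex ltac:(by rewrite i0) Fc Fb.
rewrite (_ : _ *: w + _ = b + (N^-1 *: (w.1 - xb), N^-1 *: w.2)); last first.
  apply: injective_projections => /=; last by rewrite scaler0 addr0 add0r.
  by rewrite scalerBr scalerBl scale1r addrCA.
move=> /le_trans; apply; rewrite lee_fin.
have : N^-1 * (c - m) <= 1.
  rewrite mulrC ler_pdivrMr // mul1r.
  by have := ler_norm (c - m); have := normr_ge0 (w.1 - xb); rewrite /N; lra.
by lra.
Qed.

(** Each pair [(y, s)] bounds by [s] some difference quotient at [0], in direction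
[y], of the value function [y |-> inf_x F (x, y)]. Geometrically, project the
epigraph of [F] to [Y * R] and translate [(0, m)] to the origin: this is the
cone generated by the result. *)
Let E (y : Y) (s : R) : Prop :=
  exists (t : R) (x : X), 0 < t /\ (F (x, t *: y) <= (m + t * s)%:E)%E.

(** The weights are chosen so that the two perturbations [t *: y] and [t' *: y']
get a common coefficient. *)
Let E_add y s y' s' : E y s -> E y' s' -> E (y + y') (s + s').
Proof.
move=> [t [x [t0 Fx]]] [t' [x' [t'0 Fx']]].
have tt : 0 < t + t' by rewrite addr_gt0.
pose l := t' / (t + t').
have l0 : 0 < l by rewrite divr_gt0.
have l1 : l < 1 by rewrite ltr_pdivrMr // mul1r; lra.
have lt : (1 - l) * t' = l * t by rewrite /l; field; rewrite gt_eqF.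
exists (l * t), (l *: x + (1 - l) *: x'); split; first by rewrite mulr_gt0.
have := econvex_le _ _ _ l _ _ F_convex ltac:(by rewrite l0) Fx Fx'.
rewrite (_ : l *: (_, _) + _ =
  (l *: x + (1 - l) *: x', (l * t) *: (y + y'))); last first.
  by apply: injective_projections => //=; rewrite !scalerA lt scalerDr.
by move=> /le_trans; apply; rewrite lee_fin !mulrDr !mulrA lt; lra.
Qed.

Let E_scale y s a : 0 < a -> E y s -> E (a *: y) (a * s).
Proof.
move=> a0 [t [x [t0 Fx]]]; exists (t / a), x; split; first by rewrite divr_gt0.
by rewrite scalerA mulrA divfK // gt_eqF.
Qed.

(** The value function is at most [m + 1] at [- t' *: y] for [t' = r / (2 |y|)].
If its slope in direction [y] were too negative, then the convex combination of
the two points that sits over [0] would have a value below [m]. This bounds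
slopes from below by [- (2 / r) |y|], as [cone_support] requires. *)
Lemma value_function_subgradient :
  exists v : Y, forall x y, ((m + dotp v y)%:E <= F (x, y))%E.
Proof.
have Zlin := @closed_span_linear R Y [set w.2 | w in dom F].
have Z0 : Z 0 by apply: (Z_dom b); rewrite /dom /= F_xb ltry.
have [r r0 rK] : exists2 r, 0 < r &
    forall y, Z y -> `|y| < r -> [set w.2 | w in K] y.
  apply: (@projection_nbhs0 R X Y K Z 1) => //.
  - by move=> w [].
  - move=> w [_ Fw]; have := Z_dom (b + w).
    by rewrite /= add0r; apply; rewrite /dom /= (le_lt_trans Fw) ?ltry.
  - exact: closed_closure.
have [||y s [t [x [t0 Fx]]]|v vP] := @cone_support R Y E (2 / r).
- exact: E_add.
- exact: E_scale.
- have [y0|y0] := eqVneq y 0.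
    move: Fx; rewrite y0 scaler0 normr0 mulr0 oppr0 => /(le_trans (F_min x)).
    by rewrite lee_fin lerDl pmulr_rge0.
  have ny : 0 < `|y| by rewrite normr_gt0.
  have Zy : Z y.
    have := Zlin t^-1 _ _ (Z_dom (x, t *: y) _) Z0.
    rewrite addr0 /= scalerA mulVf ?gt_eqF // scale1r; apply.
    by rewrite /dom /= (le_lt_trans Fx) ?ltry.
  pose t' := r / (2 * `|y|).
  have t'0 : 0 < t' by rewrite divr_gt0 // mulr_gt0.
  have [||w [_ Fw] wy] := rK (- t' *: y).
  + by rewrite -[_ *: _]addr0; exact: Zlin.
  + rewrite normrZ normrN gtr0_norm // (_ : _ * _ = r / 2); first by lra.
    by rewrite /t'; field; rewrite gt_eqF.
  have tt : 0 < t + t' by rewrite addr_gt0.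
  (* With this weight [t *: y] and [- t' *: y] combine to [0]. *)
  pose l := t' / (t + t').
  have l0 : 0 < l by rewrite divr_gt0.
  have l1 : l < 1 by rewrite ltr_pdivrMr // mul1r; lra.
  have lt : l * t = (1 - l) * t' by rewrite /l; field; rewrite gt_eqF.
  have := econvex_le _ _ _ l _ _ F_convex ltac:(by rewrite l0) Fx Fw.
  rewrite (_ : l *: (_, _) + _ = (l *: x + (1 - l) *: (xb + w.1), 0)); last first.
    apply: injective_projections => //=; rewrite add0r wy !scalerA lt mulrN.
    by rewrite scaleNr subrr.
  move=> /(le_trans (F_min _)); rewrite lee_fin => h.
  have : 0 <= (1 - l) * (t' * s + 1).
    by have := congr1 (fun z => z * s) lt; move: h => /=; lra.
  rewrite pmulr_rge0 ?subr_gt0 // => h'.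
  rewrite -(ler_pM2l t'0) (_ : t' * _ = -1); first by lra.
  by rewrite /t'; field; rewrite !gt_eqF.
(* A value of [F] below the affine bound, possibly [-oo], would give a point of
   the cone that violates [vP]. *)
exists v => x y; rewrite leNgt; apply/negP => Fv.
have [c cv Fc] : exists2 c : R, c < m + dotp v y & (F (x, y) <= c%:E)%E.
  move: Fv; case: (F (x, y)) => [c|//|_]; first by rewrite lte_fin; exists c.
  by exists (m + dotp v y - 1); rewrite ?leNye //; lra.
have := vP y (c - m); suff Ey : E y (c - m) by move/(_ Ey); lra.
by exists 1, x; split => //; rewrite scale1r mul1r subrKC.
Qed.

End value_function.

(** * Sums and compositions of extended-real functions *)

Lemma lower_semicontinuous_add (R : realType) (T : topologicalType)
    (f1 f2 : T -> \bar R) :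
  (forall x, f1 x != -oo%E) -> (forall x, f2 x != -oo%E) ->
  lower_semicontinuous f1 -> lower_semicontinuous f2 ->
  lower_semicontinuous (fun x => (f1 x + f2 x)%E).
Proof.
move=> N1 N2 l1 l2 x a.
have split_lt : (a%:E < f1 x + f2 x)%E ->
    exists b : R, (b%:E < f1 x)%E /\ ((a - b)%:E < f2 x)%E.
  move: (N1 x) (N2 x); case: (f1 x) => [r| |//] _; case: (f2 x) => [s| |//] _.
  - rewrite -EFinD lte_fin => ars; exists (r - (r + s - a) / 2).
    by rewrite !lte_fin; split; lra.
  - by move=> _; exists (r - 1); rewrite lte_fin ltry; split=> //; lra.
  - move=> _; exists (a - s + 1); rewrite lte_fin ltry; split=> //; lra.
  - by move=> _; exists 0; rewrite !ltry.
case/split_lt => b [b1 b2].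
have [V1 nV1 V1b] := l1 _ _ b1; have [V2 nV2 V2b] := l2 _ _ b2.
exists (V1 `&` V2); first exact: filterI.
move=> y [/V1b h1 /V2b h2].
rewrite (_ : a = b + (a - b)); last by rewrite subrKC.
by rewrite EFinD lteD.
Qed.

Lemma lower_semicontinuous_comp (R : realType) (T U : topologicalType)
    (f : U -> \bar R) (k : T -> U) :
  continuous k -> lower_semicontinuous f -> lower_semicontinuous (f \o k).
Proof.
move=> ck lf x a /= afx; have [V nV Va] := lf _ _ afx.
by exists (k @^-1` V); [exact: ck|move=> y /Va].
Qed.

Lemma econvex_add (R : realType) (V : normedModType R) (f1 f2 : V -> \bar R) :
  (forall x, f1 x != -oo%E) -> (forall x, f2 x != -oo%E) ->
  econvex f1 -> econvex f2 -> econvex (fun x => (f1 x + f2 x)%E).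
Proof.
move=> N1 N2 c1 c2 x y t t01.
have D (s : R) z : (s%:E * (f1 z + f2 z) = s%:E * f1 z + s%:E * f2 z)%E.
  by rewrite muleDr //; move: (N1 z) (N2 z); case: (f1 z); case: (f2 z).
by rewrite !D addeACA; apply: leeD; [exact: c1|exact: c2].
Qed.

Lemma econvex_comp (R : realType) (V W : normedModType R) (f : W -> \bar R)
    (k : V -> W) :
  (forall x y t, k (t *: x + (1 - t) *: y) = t *: k x + (1 - t) *: k y) ->
  econvex f -> econvex (f \o k).
Proof. by move=> kE cf x y t t01 /=; rewrite kE; exact: cf. Qed.

Lemma adde_lty (R : realType) (a b : \bar R) : a != -oo%E -> b != -oo%E ->
  (a + b < +oo)%E = (a < +oo)%E && (b < +oo)%E.
Proof. by case: a b => [r| |] [s| |] //= _ _; rewrite !ltry. Qed.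

Lemma argminP (R : realType) (V : normedModType R) (f : V -> \bar R) (x : V) :
  argmin f x <-> forall y, (f x <= f y)%E.
Proof.
split=> [-> y|fx]; first by apply: ereal_inf_lbound; exists y.
apply/eqP; rewrite eq_le; apply/andP; split; last first.
  by apply: ereal_inf_lbound; exists x.
by apply: le_ereal_inf_tmp => _ [y _ <-].
Qed.

Lemma linear_bound_continuous (R : realType) (X Y : normedModType R)
    (A : {linear X -> Y}) (M : R) :
  (forall x, `|A x| <= M * `|x|) -> continuous A.
Proof.
move=> AM; apply: bounded_linear_continuous; apply/linear_boundedP.
near=> r => x; apply: le_trans (AM x) _; exact: ler_wpM2r.
Unshelve. all: by end_near. Qed.

(** * Conditioning of a sum *)

Theorem theorem3p15 (R : realType) (X Y : hilbertType R)
    (g : X -> \bar R) (h : Y -> \bar R) (A : {linear X -> Y})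
    (g_Gamma0 : Gamma0 g) (h_Gamma0 : Gamma0 h)
    (A_bounded : exists M : R, forall x : X, `|A x| <= M * `|x|)
    (f : X -> \bar R) (fE : forall x, f x = (g x + h (A x))%E)
    (f_argmin : argmin f !=set0)
    (Omega : set X) (p : R) (p_ge1 : 1 <= p)
    (cq : sri [set y - A x | y in dom h & x in dom g] (0 : Y))
    (g_strict : strictly_convex_on_dom g)
    (g_tilt : tilt_conditioned p Omega g) :
  conditioned p Omega f /\
  exists u : X,
    conditioned p Omega (tilt g u) /\
    forall gamma : R, conditioned_with p Omega gamma (tilt g u) ->
      conditioned_with p Omega gamma f.
Proof.
have [[gN _] g_convex g_lsc] := g_Gamma0.
have [[hN _] h_convex h_lsc] := h_Gamma0.
have [M AM] := A_bounded; have A_cont := linear_bound_continuous _ _ _ _ _ AM.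
(* The perturbation function of the problem; [f] is its slice at [y = 0]. *)
pose F (w : X * Y) := (g w.1 + h (A w.1 + w.2)%R)%E.
have F0 x : F (x, 0) = f x by rewrite /F addr0 fE.
have F_dom w : dom F w <-> dom g w.1 /\ dom h (A w.1 + w.2).
  rewrite /dom /= /F adde_lty //.
  by split=> [/andP[]|[? ?]] //; apply/andP.
have F_convex : econvex F.
  apply: econvex_add => //; first exact: (econvex_comp _ _ _ g fst).
  apply: (econvex_comp _ _ _ h (fun w : X * Y => A w.1 + w.2)) => // x y t /=.
  by rewrite linearD !linearZ /= !scalerDr addrACA.
have F_lsc : lower_semicontinuous F.
  apply: lower_semicontinuous_add => //.
    by apply: (lower_semicontinuous_comp _ _ _ g fst) => // w; exact: cvg_fst.
  apply: (lower_semicontinuous_comp _ _ _ h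
    (fun w : X * Y => A w.1 + w.2)) => // w.
  apply: cvgD; last exact: cvg_snd.
  by apply: (@continuous_comp _ _ _ fst A); [exact: cvg_fst|exact: A_cont].
have fN x : f x != -oo%E.
  by rewrite fE; move: (gN x) (hN (A x)); case: (g x); case: (h (A x)).
have f_Gamma0 : Gamma0 f.
  have -> : f = F \o (fun x => (x, 0)) by apply/funext => x; rewrite /= F0.
  split; first split.
  - by move=> x; rewrite /= F0.
  - have [[y hy [x gx yx]] _] := cq; exists x; apply/F_dom; split=> //=.
    by rewrite addr0; move/eqP: yx; rewrite subr_eq0 => /eqP <-.
  - apply: econvex_comp => // x y t.
    by apply: injective_projections => //=; rewrite !scaler0 addr0.
  - apply: lower_semicontinuous_comp => // x.
    by apply: cvg_pair; [exact: cvg_id|exact: cvg_cst].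
have [xb xb_argmin] := f_argmin; have /argminP f_xb_le := xb_argmin.
have [m f_xb] : exists m, f xb = m%:E.
  have [[_ [x0 fx0]] _ _] := f_Gamma0.
  have : (f xb < +oo)%E := le_lt_trans (f_xb_le x0) fx0.
  by move: (fN xb); case: (f xb) => [m| |] //; exists m.
have cq_F : cone [set w.2 | w in dom F] = closed_span [set w.2 | w in dom F].
  have [_] := cq.
  suff -> : [set c - 0 | c in [set y - A x | y in dom h & x in dom g]]
    = [set w.2 | w in dom F] by [].
  apply/seteqP; split=> z /=.
  - move=> [_ [y hy [x gx <-]] <-]; exists (x, y - A x); last by rewrite subr0.
    by apply/F_dom; split=> //=; rewrite subrKC.
  - move=> [w /F_dom[gw hw] <-]; exists (A w.1 + w.2 - A w.1); last first.
      by rewrite subr0 addrC addKr.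
    by exists (A w.1 + w.2) => //; exists w.1.
have [v vP] : exists v : Y, forall x y, ((m + dotp v y)%:E <= F (x, y))%E.
  apply: (value_function_subgradient _ xb) => //.
    by rewrite F0 f_xb.
  by move=> x; rewrite F0 -f_xb.
have [u uA] := adjoint_vector _ _ _ _ _ AM v.
have [gb [hb [gxb hxb mE]]] : exists gb hb : R,
    [/\ g xb = gb%:E, h (A xb) = hb%:E & m = gb + hb].
  move: f_xb; rewrite fE; move: (gN xb) (hN (A xb)).
  case: (g xb) => [gb| |] //; case: (h (A xb)) => [hb| |] // _ _ [<-].
  by exists gb, hb.
have tilt_xb : tilt g u xb = (gb + dotp u xb)%:E by rewrite /tilt gxb.
(* The perturbation [A xb - A x] freezes the argument of [h] at [A xb]. *)
have tilt_min : argmin (tilt g u) xb.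
  apply/argminP => x; rewrite tilt_xb /tilt.
  have := vP x (A xb - A x); rewrite /F /= subrKC hxb dotpDr dotpNr -!uA.
  move: (gN x); case: (g x) => [r| |] //; last by move=> _ _; exact: leey.
  by rewrite !lee_fin; lra.
have tilt_inf : inf_val (tilt g u) = (gb + dotp u xb)%:E.
  by rewrite -tilt_xb.
(* Another minimiser of [tilt g u] is excluded at the midpoint. *)
have tilt_argmin z : argmin (tilt g u) z -> z = xb.
  move=> zmin; apply: contrapT => zxb.
  have tilt_z : tilt g u z = (gb + dotp u xb)%:E by rewrite zmin.
  have [gz gzE] : exists gz : R, g z = gz%:E.
    by move: (gN z) tilt_z; rewrite /tilt; case: (g z) => [r| |] //; exists r.
  have half : 0 < (2^-1 : R) < 1 by lra.
  have := g_strict z xb 2^-1 _ _ zxb half.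
  rewrite /dom /= gzE gxb !ltry => /(_ isT isT).
  have /argminP/(_ (2^-1 *: z + (1 - 2^-1) *: xb)) := tilt_min.
  move: tilt_z; rewrite tilt_xb /tilt gzE dotpDr !dotpZr => -[tz].
  case: (g _) => [r| |//]; last by move=> _; rewrite ltNge leey.
  by rewrite -!EFinM -!EFinD lee_fin lte_fin; lra.
(* The subgradient inequality of [h] at [A xb], at the point [A x]. *)
have tilt_le_f x : dom f x ->
    (tilt g u x - inf_val (tilt g u) <= f x - inf_val f)%E.
  rewrite /dom /= fE adde_lty // => /andP[gx hx].
  have := vP xb (A x - A xb); rewrite /F /= subrKC gxb -xb_argmin f_xb tilt_inf.
  rewrite dotpDr dotpNr -!uA /tilt; move: (gN x) gx (hN (A x)) hx.
  case: (g x) => [r| |] // _ _; case: (h (A x)) => [s| |] // _ _.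
  by rewrite -!EFinD !lee_fin; lra.
have transfer gamma : conditioned_with p Omega gamma (tilt g u) ->
    conditioned_with p Omega gamma f.
  move=> [_ _ gamma0 cond]; split=> // x Ox fx.
  apply: le_trans (tilt_le_f x fx); apply: le_trans (cond x Ox _); last first.
    move: fx; rewrite /dom /= fE adde_lty // /tilt => /andP[gx _].
    by rewrite adde_lty ?gx ?ltry.
  apply: lee_wpmul2l; first by rewrite lee_fin divr_ge0 // ltW //; lra.
  have nonneg (a : \bar R) : (0 <= a)%E -> a \in `[0%E, +oo%E].
    by move=> a0; rewrite in_itv /= a0 leey.
  apply: gt0_ler_poweR.
  - by lra.
  - exact/nonneg/edist_inf_ge0.
  - exact/nonneg/edist_inf_ge0.
  apply: ereal_inf_le_tmp => _ [z /tilt_argmin -> <-].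
  by exists xb.
have tilt_cond : conditioned p Omega (tilt g u).
  by case: (g_tilt u) => // nomin; move: tilt_min; rewrite nomin.
split; last by exists u.
by have [gamma /transfer gammaP] := tilt_cond; exists gamma.
Qed.
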